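(* There is an algorithm which, given an irreducible constrained homogeneous random walk $Q(t)$ in $\mathcal{Z}_+^d$ with unique stationary distribution $\pi$, a computable geometric Lyapunov function $\Phi_g:\mathcal{Z}_+^d\to[1,+\infty)$ for it with drift $0<\gamma_g<1$ and finite exception set $\mathcal{B}$ such that $$\nu_g^{\Phi}=\sup\Big\{\tfrac{\Phi_g(x')}{\Phi_g(x)}: x,x'\in\mathcal{Z}_+^d,\ p(x,x')>0\Big\}<\infty,\qquad p_{\min}^{\mathcal{B}}=\min_{x,y\in\mathcal{B}}p(x,y)>0,$$ a state $x_0\in\mathcal{Z}_+^d$ and an arbitrary $\epsilon>0$, computes a value $\hat x$ satisfying $$\pi(x_0)\in[\hat x-\epsilon,\hat x+\epsilon].$$ In other words, the stationary probability of the state $x_0$ can be computed approximately with an arbitrary degree of accuracy.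
   Context: $\mathcal{Z}_+^d$ is the set of $d$-dimensional vectors with nonnegative integer components. For $\Lambda\subset\{1,\dots,d\}$ the corresponding face is $\mathcal{Z}_\Lambda=\{z\in\mathcal{Z}_+^d: z_i>0 \text{ for } i\in\Lambda,\ z_i=0\text{ for } i\notin\Lambda\}$. A constrained homogeneous random walk in $\mathcal{Z}_+^d$ is a Markov chain $Q(t)$, $t=0,1,2,\dots$, with state space $\mathcal{Z}_+^d$ specified by finitely many numbers $p(\Lambda,\Delta)\ge 0$ ($\Lambda\subset\{1,\dots,d\}$, $\Delta\in\{-1,0,1\}^d$) such that $\sum_{\Delta}p(\Lambda,\Delta)=1$ for every $\Lambda$, and $p(\Lambda,\Delta)=0$ whenever $\Delta_i=-1$ for some $i\notin\Lambda$. If $Q(t)\in\mathcal{Z}_\Lambda$, then $Q(t+1)=Q(t)+\Delta$ with probability $p(\Lambda,\Delta)$. One writes $p(q,q')=p(\Lambda,q'-q)$ for $q\in\mathcal{Z}_\Lambda$, and $p^{(t)}(q,q')$ for the $t$-step transition probabilities. Convention on irreducibility: it is assumed that every state $q$ satisfies $p^{(t)}(q,0)>0$ for some $t\ge 0$; this is what ''irreducible'' means here. The stationary distribution $\pi$ is the probability distribution on $\mathcal{Z}_+^d$ with $\sum_{q'}\pi(q')p(q',q)=\pi(q)$ for all $q$. A function $\Phi_g:\mathcal{Z}_+^d\to[1,+\infty)$ is a geometric Lyapunov function with drift $0<\gamma_g<1$ and exception set $\mathcal{B}\subset\mathcal{Z}_+^d$ if $|\mathcal{B}|<\infty$ and for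 every state $q\notin\mathcal{B}$ $$\sum_{q'\in\mathcal{Z}_+^d}\frac{\Phi_g(q')}{\Phi_g(q)}\,p(q,q')\le\gamma_g.$$ Input data: the $p(\Lambda,\Delta)$, $\gamma_g$ and $\epsilon$ are rational numbers given explicitly, $\mathcal{B}$ is given as a finite list, and $\Phi_g$ is given by a program computing $\Phi_g(q)$ to any prescribed accuracy. *)

(* Defs.v *)
From HB Require Import structures.
From mathcomp Require Import all_boot all_order all_algebra.
From mathcomp Require Import classical_sets reals ereal esum.

Set Implicit Arguments.
Unset Strict Implicit.
Unset Printing Implicit Defensive.

Import Order.TTheory GRing.Theory Num.Theory.

Local Open Scope ring_scope.

(** Algorithms are programs of the untyped call-by-value lambda-calculus with
    recursive functions, exact rational arithmetic and pairs.  This is a Turing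
    complete model all of whose primitives are effective, and a program can be
    passed as an argument to another one.  Variables are de Bruijn indices;
    [EFun b] binds two of them in [b]: 0 is the argument and 1 is the function
    itself.  The third argument of [ECase] is the cons branch, in which 0 is
    the head and 1 is the tail. *)

Variant binop := OAdd | OSub | OMul | ODiv.

Inductive expr :=
| EVar of nat
| EFun of expr
| EApp of expr & expr
| ERat of rat
| EOp of binop & expr & expr
| EIfLe of expr & expr & expr & expr
| ENil
| ECons of expr & expr
| ECase of expr & expr & expr.

Inductive value :=
| VRat of rat
| VNil
| VCons of value & value
| VFun of seq value & expr.

Definition binop_rat (o : binop) (x y : rat) : rat :=
  match o with
  | OAdd => x + y
  | OSub => x - y
  | OMul => x * y
  | ODiv => x / y
  end.

(** [evalto env e v]: in the environment [env] the evaluation of [e] terminates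
    with the value [v].  Ill-typed programs get stuck. *)
Inductive evalto : seq value -> expr -> value -> Prop :=
| evalto_Var env n v :
    onth env n = Some v -> evalto env (EVar n) v
| evalto_Fun env b :
    evalto env (EFun b) (VFun env b)
| evalto_App env f a env' b v w :
    evalto env f (VFun env' b) -> evalto env a v ->
    evalto (v :: VFun env' b :: env') b w -> evalto env (EApp f a) w
| evalto_Rat env x :
    evalto env (ERat x) (VRat x)
| evalto_Op env o e1 e2 x y :
    evalto env e1 (VRat x) -> evalto env e2 (VRat y) ->
    evalto env (EOp o e1 e2) (VRat (binop_rat o x y))
| evalto_IfLe env e1 e2 e3 e4 x y v :
    evalto env e1 (VRat x) -> evalto env e2 (VRat y) ->
    evalto env (if x <= y then e3 else e4) v -> evalto env (EIfLe e1 e2 e3 e4) v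
| evalto_Nil env :
    evalto env ENil VNil
| evalto_Cons env e1 e2 v w :
    evalto env e1 v -> evalto env e2 w -> evalto env (ECons e1 e2) (VCons v w)
| evalto_CaseNil env e e1 e2 v :
    evalto env e VNil -> evalto env e1 v -> evalto env (ECase e e1 e2) v
| evalto_CaseCons env e e1 e2 h t v :
    evalto env e (VCons h t) -> evalto (h :: t :: env) e2 v ->
    evalto env (ECase e e1 e2) v.

Lemma evalto_det env e v w : evalto env e v -> evalto env e w -> v = w.
Proof.
move=> ev; elim: ev w => {env e v}; intros; subst;
  match goal with H : evalto _ _ ?w |- _ = ?w => inversion H; subst end;
  repeat match goal with
    | IH : forall w, evalto ?env ?e w -> _ = w, H : evalto ?env ?e _ |- _ =>
        have := IH _ H; clear H; intro
    | H : VRat _ = VRat _ |- _ => case: H => ?; subst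
    | H : VFun _ _ = VFun _ _ |- _ => case: H => ? ?; subst
    | H : VCons _ _ = VCons _ _ |- _ => case: H => ? ?; subst
    end; congruence.
Qed.

Definition state (d : nat) := {ffun 'I_d -> nat}.

Definition origin (d : nat) : state d := [ffun=> 0%N].

(** The increments, i.e. the vectors of {-1, 0, 1}^d; the digit [D i] of 'I_3
    stands for the component [D i - 1]. *)
Definition increment (d : nat) := {ffun 'I_d -> 'I_3}.

Definition incr_val (d : nat) (D : increment d) (i : 'I_d) : int :=
  (D i : nat)%:Z - 1.

Record walk (d : nat) := Walk {
  prob : {set 'I_d} -> increment d -> rat;
  prob_ge0 : forall L D, 0 <= prob L D;
  prob_sum1 : forall L, \sum_(D : increment d) prob L D = 1;
  prob_constrained : forall (L : {set 'I_d}) D i,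
    i \notin L -> incr_val D i = -1 -> prob L D = 0 }.

(** The unique L such that [q] belongs to the face Z_L. *)
Definition face (d : nat) (q : state d) : {set 'I_d} :=
  [set i | (0 < q i)%N]%SET.

(** p(q, q') = p(L, q' - q) for q in Z_L: the sum has at most one term, and
    none when q' - q is not in {-1, 0, 1}^d. *)
Definition trans (d : nat) (W : walk d) (q q' : state d) : rat :=
  \sum_(D : increment d | [forall i, (q' i)%:Z - (q i)%:Z == incr_val D i])
     prob W (face q) D.

Fixpoint trans_iter (R : realType) (d : nat) (W : walk d) (t : nat)
    (q q' : state d) : \bar R :=
  if t is t'.+1 then
    \esum_(r in [set: state d]%classic)
       ((ratr (trans W q r))%:E * trans_iter R W t' r q')%E
  else ((q == q')%:R)%:E.

(** Weaker than the usual notion: only the origin has to be reachable. *)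
Definition irreducible (R : realType) (d : nat) (W : walk d) : Prop :=
  forall q : state d, exists t : nat, (0 < trans_iter R W t q (origin d))%E.

Definition stationary (R : realType) (d : nat) (W : walk d)
    (pi : state d -> R) : Prop :=
  [/\ forall q, 0 <= pi q,
      \esum_(q in [set: state d]%classic) (pi q)%:E = 1%E
    & forall q, \esum_(q' in [set: state d]%classic)
                   (pi q' * ratr (trans W q' q))%:E = (pi q)%:E].

Definition unique_stationary (R : realType) (d : nat) (W : walk d)
    (pi : state d -> R) : Prop :=
  stationary W pi /\ forall pi' : state d -> R, stationary W pi' -> pi' =1 pi.

Definition geometric_lyapunov (R : realType) (d : nat) (W : walk d)
    (Phi : state d -> R) (gamma : rat) (B : seq (state d)) : Prop :=
  [/\ forall q, 1 <= Phi q,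
      0 < gamma < 1
    & forall q, q \notin B ->
        (\esum_(q' in [set: state d]%classic)
            (Phi q' / Phi q * ratr (trans W q q'))%:E <= (ratr gamma)%:E)%E].

Definition nu (R : realType) (d : nat) (W : walk d) (Phi : state d -> R) :
    \bar R :=
  ereal_sup [set r | exists x x' : state d,
                0 < trans W x x' /\ r = (Phi x' / Phi x)%:E]%classic.

(** The minimum of p(x, y) over x, y in B; the default 1 of the iterated
    minimum is an upper bound of all the p(x, y). *)
Definition pmin (d : nat) (W : walk d) (B : seq (state d)) : rat :=
  \big[Num.min/1]_(x <- B) \big[Num.min/1]_(y <- B) trans W x y.

Definition enc_seq (s : seq expr) : expr := foldr ECons ENil s.

Definition enc_state (d : nat) (q : state d) : expr :=
  enc_seq [seq ERat (q i)%:R | i <- enum 'I_d].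

Definition enc_set (d : nat) (L : {set 'I_d}) : expr :=
  enc_seq [seq ERat (i \in L)%:R | i <- enum 'I_d].

Definition enc_increment (d : nat) (D : increment d) : expr :=
  enc_seq [seq ERat (incr_val D i)%:~R | i <- enum 'I_d].

Definition enc_walk (d : nat) (W : walk d) : expr :=
  enc_seq [seq enc_seq [:: enc_set L; enc_increment D; ERat (prob W L D)]
          | L <- enum {set 'I_d}, D <- enum (increment d)].

Definition enc_input (d : nat) (W : walk d) (gamma : rat) (B : seq (state d))
    (x0 : state d) (eps : rat) : expr :=
  enc_seq [:: ERat d%:R; enc_walk W; ERat gamma;
              enc_seq [seq enc_state q | q <- B]; enc_state x0; ERat eps].

(** [P] takes the state and the accuracy in curried form and returns a rational
    approximation. *)
Definition computes (R : realType) (d : nat) (P : expr) (Phi : state d -> R) :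
    Prop :=
  forall (q : state d) (delta : rat), 0 < delta ->
  exists r : rat,
    evalto [::] (EApp (EApp P (enc_state q)) (ERat delta)) (VRat r) /\
    `|ratr r - Phi q| <= ratr delta.

(* Main.v *)
Require Import Defs.
From mathcomp Require Import all_boot all_order all_algebra.
From mathcomp Require Import finmap boolp classical_sets cardinality fsbigop.
From mathcomp Require Import reals ereal esum.
From mathcomp Require Import ring lra zify.
Set Implicit Arguments.
Unset Strict Implicit.
Unset Printing Implicit Defensive.
Import Order.TTheory GRing.Theory Num.Theory.
Local Open Scope ring_scope.

(** Let a be the first element of B, and let G be the transition operator of
    the walk killed when it enters a.  By Kac's formula pi(x0) is the expected
    number of visits to x0 between two visits to a, divided by the expected
    time between two visits to a.  Truncated at time n these two expectations
    become h_n(1_x0)(a) and h_n(1)(a), with h_n = 1 + G + ... + G^(n-1)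
    ([occupation]), and both are finite sums of rational numbers.  The
    algorithm returns their ratio for a suitable n.

    The error is controlled by the identity
      pi(f) = pi(a) h_n(f)(a) + pi(G^n f)                  ([integral_occupation])
    applied to f = 1_x0 and to f = 1: it shows that the ratio differs from
    pi(x0) by at most pi(G^n 1).  To bound this remainder, Phi is turned into a
    function V >= 1 with G V <= rho V at all states, a and B included
    ([killed_drift]): V = Phi + M works with rho = (gamma + M) / (1 + M), as
    soon as M p(x, a) >= E_x Phi(Q(1)) for all x in B.  Since pmin > 0, such an
    M exists and is computable from upper approximations of Phi near B.
    Iterating the drift gives h_N(G^n 1) <= rho^n V / (1 - rho) for all N; as
    pi(G^N 1) tends to 0, the identity at time N leaves
      pi(G^n 1) <= rho^n V(a) / (1 - rho)                  ([integral_killed_le]).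
    Hence n may be taken to be the first time at which a computable upper bound
    of the right-hand side is at most eps.

    The program carries w = C rho^k instead of a clock, stops when w <= eps, and
    is shown to be correct by giving the real number denoted by each of its
    parts ([evals]).  B is not empty, because otherwise Phi >= gamma^(-n) would
    hold for all n ([lyapunov_exception_nonempty]). *)

(** * Unconditional sums *)

Section Esum.
Variables (R : realType) (T : choiceType).
Implicit Types (a : T -> \bar R).

Lemma ge0_esumZl (r : R) a : 0 <= r -> (forall i, 0 <= a i)%E ->
  \esum_(i in [set: T]) (r%:E * a i)%E = (r%:E * \esum_(i in [set: T]) a i)%E.
Proof.
move=> r0 a0; rewrite /esum -ereal_supZl //; last first.
  by apply/set0P; exists 0%E, set0; [exact: fsets_set0 | rewrite fsbig_set0].
congr ereal_sup; apply/seteqP; split=> x /=.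
  move=> [X XT <-]; exists (\sum_(i \in X) a i)%E; first by exists X.
  by rewrite ge0_mule_fsumr.
by move=> [_ [X XT <-] <-]; exists X; rewrite // ge0_mule_fsumr.
Qed.

Lemma esum_dirac (x : T) (r : R) : 0 <= r ->
  \esum_(i in [set: T]) ((x == i)%:R * r)%:E = r%:E.
Proof.
move=> r0; rewrite -[RHS](@esum_set1 _ _ x (fun=> r%:E)) ?lee_fin //.
rewrite [RHS]esum_mkcond; apply: eq_esum => i _.
have [<-|xi] := eqVneq x i; first by rewrite mem_set // mul1r.
by rewrite memNset ?mul0r // => /= ix; rewrite ix eqxx in xi.
Qed.

Lemma esum_exchange (a : T -> T -> \bar R) : (forall i j, 0 <= a i j)%E ->
  \esum_(i in [set: T]) \esum_(j in [set: T]) a i j =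
  \esum_(j in [set: T]) \esum_(i in [set: T]) a i j.
Proof.
move=> a0; rewrite !esum_esum //.
rewrite (reindex_esum ([set: T] `*`` (fun=> [set: T]))%classic
  ([set: T] `*`` (fun=> [set: T]))%classic (fun k => (k.2, k.1))) //.
split=> //= [[i j] [i' j'] _ _ /= [-> ->]|[i j] _] //.
by exists (j, i).
Qed.

Lemma esum_tail_small (f : T -> R) (e : R) : (forall i, 0 <= f i) ->
  \esum_(i in [set: T]) (f i)%:E = 1%E -> 0 < e ->
  exists F : seq T,
    (\esum_(i in [set: T]) (f i * (i \notin F)%:R)%:E <= e%:E)%E.
Proof.
move=> f0 f1 e0.
have : ((1 - e)%:E < \esum_(i in [set: T]) (f i)%:E)%E.
  by rewrite f1 lte_fin ltrBlDr ltrDl.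
move=> /ereal_sup_gt [_ [X [finX _] <-] lX].
exists (fset_set X).
have -> : \esum_(i in [set: T]) (f i * (i \notin fset_set X)%:R)%:E =
    \esum_(i in ~` X) (f i)%:E.
  rewrite [RHS]esum_mkcond; apply: eq_esum => i _.
  rewrite in_setC in_fset_set //.
  by case: (i \in X); rewrite /= ?mulr0 ?mulr1.
move: f1; rewrite (esumID X) => [|i _]; last by rewrite lee_fin.
have -> : \esum_(i in [set: T] `&` X) (f i)%:E = (\sum_(i <- fset_set X) f i)%:E.
  rewrite setTI -sumEFin -fsbig_finite // -esum_fset // ?set_mem_set // => i _.
  by rewrite lee_fin.
rewrite setTI; move: lX; rewrite fsbig_finite //= sumEFin lte_fin.
case: (\esum_(i in ~` X) _) => [t| |] //; rewrite -EFinD lee_fin.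
by move=> lX [fX]; lra.
Qed.
End Esum.

(** * Geometric sequences *)

Lemma expr_mul_small (F : archiRealFieldType) (r c e : F) :
  0 < r < 1 -> 0 <= c -> 0 < e -> exists n, r ^+ n * c <= e.
Proof.
move=> /andP [r0 r1] c0 e0.
have t0 : 0 < 1 - r by rewrite subr_gt0.
have te0 : 0 < (1 - r) * e by rewrite mulr_gt0.
exists (Num.bound (c / ((1 - r) * e))); set n := Num.bound _.
have : c / ((1 - r) * e) < n%:R by apply: archi_boundP; rewrite divr_ge0 // ltW.
rewrite ltr_pdivrMr // => cn.
have Bernoulli k : r ^+ k * (1 + k%:R * (1 - r)) <= 1.
  elim: k => [|k IH]; first by rewrite mul0r addr0 mulr1.
  apply: le_trans IH; rewrite exprSr -mulrA ler_wpM2l ?exprn_ge0 ?(ltW r0) //.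
  rewrite -natr1; move: (ler0n F k) (sqr_ge0 (1 - r)); move: k%:R => x x0 s0.
  have := mulr_ge0 x0 s0; nra.
have rn : 0 <= r ^+ n by rewrite exprn_ge0 // ltW.
apply: (@le_trans _ _ (r ^+ n * (n%:R * ((1 - r) * e)))).
  by rewrite ler_wpM2l // ltW.
rewrite (_ : _ * _ = e * (r ^+ n * (n%:R * (1 - r)))); last by ring.
rewrite ger_pMr // (le_trans _ (Bernoulli n)) // ler_wpM2l // lerDr.
exact: ler01.
Qed.

Lemma expr_mul_threshold (F : archiRealFieldType) (r c e : F) :
  0 < r < 1 -> 0 <= c -> 0 < e ->
  exists n, forall k, (c * r ^+ k <= e) = (n <= k)%N.
Proof.
move=> r01 c0 e0; have [n0 n0P] := expr_mul_small r01 c0 e0.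
have ex : exists n, c * r ^+ n <= e by exists n0; rewrite mulrC.
exists (ex_minn ex) => k; case: ex_minnP => n nP n_min.
apply/idP/idP => [|nk]; first exact: n_min.
apply: le_trans nP; rewrite ler_wpM2l // ler_wiXn2l //.
- by case/andP: r01 => /ltW.
- by case/andP: r01 => _ /ltW.
Qed.

(** * The walk killed at a state *)

Section Walk.
Variables (R : realType) (d : nat) (W : walk d).
Implicit Types (q a : state d) (f g : state d -> R).

Definition step q (D : increment d) : state d := [ffun i => (q i + D i).-1].

Definition mean f q : R := \sum_D ratr (prob W (face q) D) * f (step q D).

(** A rule of positive probability never leads out of the orthant, so the
    truncated predecessor in [step] is then a true one. *)
Lemma step_eq q q' D : prob W (face q) D != 0 ->
  [forall i, (q' i)%:Z - (q i)%:Z == incr_val D i] = (step q D == q').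
Proof.
move=> pD0.
have qD i : (0 < q i + D i)%N.
  rewrite lt0n addn_eq0; apply/negP => /andP [/eqP qi /eqP Di].
  case/eqP: pD0; apply: (@prob_constrained _ _ _ _ i).
    by rewrite inE qi.
  by rewrite /incr_val Di.
apply/forallP/eqP => [h|<- i].
  apply/ffunP => i; move/eqP: (h i) (qD i); rewrite ffunE /incr_val.
  by move: (q i) (q' i) (nat_of_ord (D i)) => x y z; lia.
rewrite /step ffunE /incr_val; move: (qD i); move: (q i) (nat_of_ord (D i)) => x n.
by move=> qn; apply/eqP; lia.
Qed.

Lemma transE q q' :
  trans W q q' = \sum_D prob W (face q) D * (step q D == q')%:R.
Proof.
rewrite /trans big_mkcond; apply: eq_bigr => D _.
have [->|pD0] := eqVneq (prob W (face q) D) 0; first by rewrite mul0r if_same.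
by rewrite step_eq //; case: eqP; rewrite ?mulr1 ?mulr0.
Qed.

Lemma ratr_prob_ge0 L D : 0 <= ratr (prob W L D) :> R.
Proof. by rewrite ler0q prob_ge0. Qed.

Lemma ratr_trans q q' : ratr (trans W q q') = mean (fun x => (x == q')%:R) q.
Proof.
rewrite transE /mean rmorph_sum /=; apply: eq_bigr => D _.
by rewrite rmorphM /= ratr_nat.
Qed.

Lemma mean_esum f q : (forall x, 0 <= f x) ->
  \esum_(q' in [set: state d]) (f q' * ratr (trans W q q'))%:E = (mean f q)%:E.
Proof.
move=> f0; pose p D : R := ratr (prob W (face q) D).
have e q' : (f q' * ratr (trans W q q'))%:E =
    (\sum_(D : increment d) ((step q D == q')%:R * (p D * f (step q D)))%:E)%E.
  rewrite sumEFin ratr_trans mulr_sumr; congr _%:E; apply: eq_bigr => D _.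
  by case: eqP => [->|_]; rewrite ?mulr0 ?mul0r // mulr1 mul1r mulrC.
under eq_esum => q' _ do rewrite e.
rewrite esum_sum => [|q' D _ _]; last first.
  by rewrite lee_fin mulr_ge0 // mulr_ge0 //; exact: ratr_prob_ge0.
rewrite /mean -sumEFin; apply: eq_bigr => D _.
by rewrite esum_dirac // mulr_ge0 ?ratr_prob_ge0.
Qed.

Lemma le_mean f g q : (forall x, f x <= g x) -> mean f q <= mean g q.
Proof. by move=> fg; apply: ler_sum => D _; rewrite ler_wpM2l ?ratr_prob_ge0. Qed.

Lemma mean_ge0 f q : (forall x, 0 <= f x) -> 0 <= mean f q.
Proof. by move=> f0; apply: sumr_ge0 => D _; rewrite mulr_ge0 ?ratr_prob_ge0. Qed.

Lemma meanD f g q : mean (fun x => f x + g x) q = mean f q + mean g q.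
Proof. by rewrite -big_split; apply: eq_bigr => D _; rewrite /= mulrDr. Qed.

Lemma meanZ c f q : mean (fun x => c * f x) q = c * mean f q.
Proof. by rewrite mulr_sumr; apply: eq_bigr => D _; rewrite mulrCA. Qed.

Lemma eq_mean f g q : f =1 g -> mean f q = mean g q.
Proof. by move=> fg; apply: eq_bigr => D _; rewrite fg. Qed.

Lemma mean_cst c q : mean (fun=> c) q = c.
Proof.
by rewrite /mean -mulr_suml -rmorph_sum /= prob_sum1 rmorph1 mul1r.
Qed.

(** The chain disappears on entering a, but may start there. *)
Definition killed a f := mean (fun x => (x != a)%:R * f x).

Fixpoint occupation a n f q : R :=
  if n is n'.+1 then f q + killed a (occupation a n' f) q else 0.

Variable a : state d.
Local Notation G := (killed a).

Lemma le_killed f g q : (forall x, f x <= g x) -> G f q <= G g q.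
Proof. by move=> fg; apply: le_mean => x; rewrite ler_wpM2l. Qed.

Lemma killed_ge0 f q : (forall x, 0 <= f x) -> 0 <= G f q.
Proof. by move=> f0; apply: mean_ge0 => x; rewrite mulr_ge0. Qed.

Lemma killedD f g q : G (fun x => f x + g x) q = G f q + G g q.
Proof. by rewrite -meanD; apply: eq_mean => x; rewrite mulrDr. Qed.

Lemma killedZ c f q : G (fun x => c * f x) q = c * G f q.
Proof. by rewrite -meanZ; apply: eq_mean => x; rewrite mulrCA. Qed.

Lemma eq_killed f g q : f =1 g -> G f q = G g q.
Proof. by move=> fg; apply: eq_mean => x; rewrite fg. Qed.

Lemma killed_iter_ge0 n f q : (forall x, 0 <= f x) -> 0 <= iter n G f q.
Proof. by move=> f0; elim: n q => [|n IH] q //=; apply: killed_ge0. Qed.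

Lemma le_killed_iter n f g q :
  (forall x, f x <= g x) -> iter n G f q <= iter n G g q.
Proof. by move=> fg; elim: n q => [|n IH] q //=; apply: le_killed. Qed.

Lemma killed_iter_le1 n q : iter n G (fun=> 1) q <= 1.
Proof.
elim: n q => [|n IH] q //=; rewrite -[leRHS](mean_cst 1 q).
by apply: le_mean => x; case: (x != a); rewrite ?mul1r ?mul0r ?ler01.
Qed.

Lemma occupation_ge0 n f q : (forall x, 0 <= f x) -> 0 <= occupation a n f q.
Proof.
by move=> f0; elim: n q => [|n IH] q //=; rewrite addr_ge0 // killed_ge0.
Qed.

Lemma le_occupation n f g q :
  (forall x, f x <= g x) -> occupation a n f q <= occupation a n g q.
Proof.
by move=> fg; elim: n q => [|n IH] q //=; rewrite lerD // le_killed.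
Qed.

(** The defining recursion splits off the first step of the walk, as the program
    does; this one lets G act on f, as the iteration of the stationarity
    equation requires. *)
Lemma occupationSr n f q :
  occupation a n.+1 f q = f q + occupation a n (G f) q.
Proof.
elim: n q => [|n IH] q.
  by rewrite /= /killed /mean big1 // => D _; rewrite !mulr0.
rewrite -/(f q + G (occupation a n.+1 f) q); congr (_ + _).
by rewrite (eq_killed q IH) killedD.
Qed.

Section Drift.
Variables (V : state d -> R) (rho : R).
Hypotheses (V1 : forall q, 1 <= V q) (rho01 : 0 < rho < 1).
Hypothesis drift : forall q, G V q <= rho * V q.

Lemma killed_iter_decay n q : iter n G (fun=> 1) q <= rho ^+ n * V q.
Proof.
case/andP: rho01 => rho0 _.
elim: n q => [|n IH] q; first by rewrite /= mul1r V1.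
rewrite /= (le_trans (le_killed _ IH)) // killedZ exprSr -mulrA.
by rewrite ler_wpM2l // exprn_ge0 // ltW.
Qed.

(** V / (1 - rho) is superharmonic with a margin V, so that it dominates the
    total occupation of any f <= V. *)
Lemma occupation_decay n c f q : 0 <= c -> (forall x, f x <= c * V x) ->
  occupation a n f q <= c * V q / (1 - rho).
Proof.
case/andP: rho01 => rho0 rho1 c0 fV.
elim: n q => [|n IH] q /=.
  by rewrite divr_ge0 ?mulr_ge0 ?subr_ge0 ?(ltW rho1) // (le_trans ler01).
have r0 : 1 - rho != 0 by rewrite subr_eq0 gt_eqF.
have -> : c * V q / (1 - rho) = c * V q + c / (1 - rho) * (rho * V q).
  by field.
rewrite lerD //.
apply: (@le_trans _ _ (G (fun x => c / (1 - rho) * V x) q)).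
  by apply: le_killed => x; rewrite (le_trans (IH x)) // mulrAC.
by rewrite killedZ ler_wpM2l // divr_ge0 // subr_ge0 ltW.
Qed.
End Drift.

(** * Kac's formula with a remainder *)

Section Stationary.
Variables (pi : state d -> R).
Hypothesis piP : stationary W pi.

Definition integral f : \bar R := \esum_(q in [set: state d]) (pi q * f q)%:E.

Let pi0 q : 0 <= pi q. Proof. by case: piP. Qed.

Lemma le_integral f g : (forall q, f q <= g q) -> (integral f <= integral g)%E.
Proof. by move=> fg; apply: le_esum => q _; rewrite lee_fin ler_wpM2l. Qed.

Lemma integral_ge0 f : (forall q, 0 <= f q) -> (0 <= integral f)%E.
Proof. by move=> f0; apply: esum_ge0 => q _; rewrite lee_fin mulr_ge0. Qed.

Lemma integral1 : integral (fun=> 1) = 1%E.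
Proof.
by case: piP => _ <- _; apply: eq_esum => q _; rewrite mulr1.
Qed.

Lemma integral_indic x : integral (fun q => (x == q)%:R) = (pi x)%:E.
Proof.
rewrite -[RHS](esum_dirac x) //; apply: eq_esum => q _.
by case: eqP => [->|]; rewrite ?mulr1 ?mul1r ?mulr0 ?mul0r.
Qed.

Lemma stationary_le1 q : pi q <= 1.
Proof.
rewrite -lee_fin -integral_indic -integral1; apply: le_integral => x.
by case: eqP.
Qed.

Lemma integralD f g : (forall q, 0 <= f q) -> (forall q, 0 <= g q) ->
  integral (fun q => f q + g q) = (integral f + integral g)%E.
Proof.
move=> f0 g0; rewrite -esumD => [|q _|q _]; rewrite ?lee_fin ?mulr_ge0 //.
by apply: eq_esum => q _; rewrite mulrDr.
Qed.

Lemma integralZ c f : 0 <= c -> (forall q, 0 <= f q) ->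
  integral (fun q => c * f q) = (c%:E * integral f)%E.
Proof.
move=> c0 f0; rewrite -ge0_esumZl // => [|q]; rewrite ?lee_fin ?mulr_ge0 //.
by apply: eq_esum => q _; rewrite mulrCA.
Qed.

Lemma integral_mean f : (forall q, 0 <= f q) ->
  integral (mean f) = integral f.
Proof.
move=> f0; transitivity (\esum_(q in [set: state d]) \esum_(x in [set: state d])
    (pi q * f x * ratr (trans W q x))%:E).
  apply: eq_esum => q _; rewrite (@mean_esum (fun x => pi q * f x)).
    by rewrite meanZ.
  by move=> x; rewrite mulr_ge0.
have t0 q x : 0 <= ratr (trans W q x) :> R by rewrite ratr_trans mean_ge0.
rewrite esum_exchange => [|q x]; last by rewrite lee_fin mulr_ge0 // mulr_ge0.
apply: eq_esum => x _; case: piP => _ _ stat.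
under eq_esum => q _ do rewrite mulrAC mulrC EFinM.
rewrite ge0_esumZl ?stat -?EFinM 1?mulrC // => q.
by rewrite lee_fin mulr_ge0.
Qed.

(** By stationarity pi(f 1_(not a)) = pi(E(f 1_(not a))) = pi(G f). *)
Lemma integral_killed f : (forall q, 0 <= f q) ->
  integral f = ((pi a * f a)%:E + integral (G f))%E.
Proof.
move=> f0; rewrite /killed integral_mean => [|q]; last by rewrite mulr_ge0.
have -> : (pi a * f a)%:E = integral (fun q => f a * (a == q)%:R).
  by rewrite integralZ // integral_indic -EFinM mulrC.
rewrite -integralD => [|q|q]; rewrite ?mulr_ge0 //.
apply: eq_esum => q _; rewrite eq_sym.
by case: eqP => [->|_]; rewrite /= ?(mulr1, mulr0, mul1r, mul0r, addr0, add0r).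
Qed.

(** The truncated Kac formula: the last term is the contribution of the paths
    that do not enter a during n steps. *)
Lemma integral_occupation n f : (forall q, 0 <= f q) ->
  integral f = ((pi a * occupation a n f a)%:E + integral (iter n G f))%E.
Proof.
elim: n f => [|n IH] f f0; first by rewrite mulr0 add0e.
rewrite integral_killed // (IH (G f)) => [|q]; last exact: killed_ge0.
by rewrite occupationSr mulrDr EFinD addeA -iterSr.
Qed.

Section Drift.
Variables (V : state d -> R) (rho : R).
Hypotheses (V1 : forall q, 1 <= V q) (rho01 : 0 < rho < 1).
Hypothesis drift : forall q, G V q <= rho * V q.

(** All but a small part of the mass of pi lies in a finite set, where
    G^m 1 <= rho^m V decays uniformly; elsewhere G^m 1 <= 1 suffices.  This
    avoids proving that V is pi-integrable. *)
Lemma integral_killed_small (e : R) : 0 < e ->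
  exists m, (integral (iter m G (fun=> 1%R)) <= e%:E)%E.
Proof.
move=> e0; have [_ pi1 _] := piP.
have rn0 m : 0 <= rho ^+ m by rewrite exprn_ge0 // ltW //; case/andP: rho01.
have [F Fe] := esum_tail_small pi0 pi1 (divr_gt0 e0 (ltr0Sn R 1)).
have V0 q : 0 <= V q by apply: le_trans (V1 q).
pose S := \sum_(q <- F) V q.
have S0 : 0 <= S by apply: sumr_ge0.
have [m mS] : exists m, rho ^+ m * S <= e / 2.
  by apply: expr_mul_small => //; rewrite divr_gt0.
exists m; apply: (@le_trans _ _
    (integral (fun q => rho ^+ m * S * 1 + (q \notin F)%:R))).
  apply: le_integral => q; have [qF|qF] := boolP (q \in F).
    rewrite addr0 mulr1 (le_trans (killed_iter_decay V1 rho01 drift m q)) //.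
    by rewrite ler_wpM2l // /S (big_rem q) //= lerDl sumr_ge0.
  by rewrite (le_trans (killed_iter_le1 m q)) // lerDr mulr1 mulr_ge0.
have rS0 : 0 <= rho ^+ m * S by rewrite mulr_ge0.
rewrite (@integralD (fun=> rho ^+ m * S * 1)
  (fun q => (q \notin F)%:R)) => [|q|q]; rewrite ?mulr_ge0 //.
rewrite [X in (X + _)%E](@integralZ _ (fun=> 1)) // integral1 mule1.
by rewrite [in leRHS](splitr e) EFinD leeD.
Qed.

(** Applying [integral_occupation] to G^n 1 up to a large time m leaves an
    arbitrarily small remainder, and the main term is bounded uniformly in m. *)
Lemma integral_killed_le n :
  (integral (iter n G (fun=> 1%R)) <= (rho ^+ n * V a / (1 - rho))%:E)%E.
Proof.
case/andP: rho01 => rho0 rho1.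
have V0 q : 0 <= V q by apply: le_trans (V1 q).
apply/lee_addgt0Pr => e e0; have [m Im] := integral_killed_small e0.
rewrite (@integral_occupation m) => [|q]; last exact: killed_iter_ge0.
rewrite leeD //; last first.
  apply: le_trans Im; apply: le_integral => q; apply: le_killed_iter => x.
  exact: killed_iter_le1.
rewrite lee_fin -[leRHS]mul1r ler_pM ?stationary_le1 //.
  by apply: occupation_ge0 => x; apply: killed_iter_ge0.
apply: (@occupation_decay V rho) => // [|x]; first by rewrite exprn_ge0 // ltW.
exact: killed_iter_decay.
Qed.

(** With f and m the two occupations at a, r = pi(G^n 1) and 0 <= s <= r, one
    has pi(x0) = pi(a) f + s and 1 = pi(a) m + r, so that
    pi(x0) - f / m = s - (f / m) r, where f / m lies in [0, 1]. *)
Lemma ratio_estimate n x0 :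
  `|pi x0 - occupation a n (fun q => (q == x0)%:R) a
            / occupation a n (fun=> 1) a| <= rho ^+ n * V a / (1 - rho).
Proof.
set f := occupation a n _ a; set m := occupation a n _ a.
have f0 : 0 <= f by apply: occupation_ge0.
have fm : f <= m by apply: le_occupation => q; case: eqP.
have If := integral_occupation n (fun q => ler0n R (q == x0)).
have Im := integral_occupation n (fun q : state d => @ler01 R).
have rE := integral_killed_le n.
have sr : (integral (iter n G (fun q => (q == x0)%:R%R))
    <= integral (iter n G (fun=> 1%R)))%E.
  by apply: le_integral => q; apply: le_killed_iter => x; case: eqP.
have s0 : (0 <= integral (iter n G (fun q => (q == x0)%:R%R)))%E.
  by apply: integral_ge0 => q; apply: killed_iter_ge0.
have e : integral (fun q => (q == x0)%:R) = (pi x0)%:E.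
  by rewrite -integral_indic; apply: eq_esum => q _; rewrite eq_sym.
move: If Im rE sr s0; rewrite e integral1 -/f -/m.
case: (integral (iter n G (fun q => (q == x0)%:R))) => [s| |] //;
  case: (integral (iter n G (fun=> 1))) => [r| |] //.
rewrite -!EFinD !lee_fin => -[If] -[Im] rE sr s0.
apply: le_trans rE.
(* For m = 0, which is n = 0, the convention f / 0 = 0 is harmless: then r = 1. *)
have [m0|m0] := eqVneq m 0.
  have f00 : f = 0 by lra.
  by rewrite m0 invr0 mulr0 subr0 If f00 mulr0 add0r ger0_norm //; lra.
have mp : 0 < m by lra.
have -> : pi x0 - f / m = s - f / m * r.
  by rewrite If (_ : r = 1 - pi a * m); [field | lra].
have : 0 <= f / m <= 1 by rewrite divr_ge0 ?(ltW mp) //= ler_pdivrMr // mul1r.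
by move=> /andP[? ?]; rewrite ler_norml; apply/andP; split; nra.
Qed.
End Drift.
End Stationary.
End Walk.

(** * A drift towards a single state *)

Lemma ratr_lt01 (R : realType) (r : rat) : 0 < r < 1 -> 0 < (ratr r : R) < 1.
Proof. by move=> /andP [r0]; rewrite ltr0q r0 -(ltr_rat R) rmorph1. Qed.

Section Lyapunov.
Variables (R : realType) (d : nat) (W : walk d).
Variables (Phi : state d -> R) (gamma : rat) (B : seq (state d)).
Hypothesis lyap : geometric_lyapunov W Phi gamma B.

Lemma lyapunov_mean q : q \notin B -> mean W Phi q <= ratr gamma * Phi q.
Proof.
case: lyap => Phi1 _ drift /drift.
have Phi0 x : 0 < Phi x by apply: lt_le_trans (Phi1 x).
rewrite (@mean_esum _ _ _ (fun x => Phi x / Phi q)) => [|x]; last first.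
  by rewrite divr_ge0 // ltW.
rewrite lee_fin (@eq_mean _ _ _ _ (fun x => (Phi q)^-1 * Phi x)) => [|x].
  by rewrite meanZ mulrC ler_pdivrMr.
by rewrite mulrC.
Qed.

(** A drift at every state would give Phi(q) >= gamma^(-n) for all n. *)
Lemma lyapunov_exception_nonempty : B != [::].
Proof.
apply/eqP => B0; have [Phi1 g01 _] := lyap.
have g01' := ratr_lt01 R g01.
have Phig n q : 1 <= ratr gamma ^+ n * Phi q.
  elim: n q => [|n IH] q; first by rewrite mul1r.
  rewrite exprSr -mulrA (le_trans _ (_ : ratr gamma ^+ n * mean W Phi q <= _)) //.
    by rewrite -meanZ -[leLHS](mean_cst W 1 q) le_mean.
  rewrite ler_wpM2l ?exprn_ge0 ?lyapunov_mean ?B0 //.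
  by case/andP: g01' => /ltW.
pose o : state d := origin d.
have Phi0 : 0 <= Phi o by apply: le_trans (Phi1 o).
have h : 0 < 2^-1 :> R by rewrite invr_gt0.
have [n] := expr_mul_small g01' Phi0 h.
have := Phig n o; lra.
Qed.

Lemma mean_killed (a : state d) (f : state d -> R) q :
  mean W f q = killed W a f q + f a * ratr (trans W q a).
Proof.
rewrite ratr_trans -meanZ -meanD; apply: eq_mean => x.
by case: eqP => [->|_]; rewrite ?(mul1r, mul0r, mulr1, mulr0, add0r, addr0).
Qed.

(** Outside B the constant M spoils the drift gamma of Phi only down to
    (gamma + M) / (1 + M), because Phi >= 1.  On B the mass p(x, a) lost by
    killing compensates for the growth of Phi: E_x Phi + M (1 - p(x, a)) <= M. *)
Lemma killed_drift (a : state d) (M : R) :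
    0 <= M -> (forall x, x \in B -> mean W Phi x <= M * ratr (trans W x a)) ->
  forall q, killed W a (fun x => Phi x + M) q <=
    (ratr gamma + M) / (1 + M) * (Phi q + M).
Proof.
move=> M0 MB q; have [Phi1 g01 _] := lyap.
have /andP [g0 g1] := ratr_lt01 R g01.
have M1 : 0 < 1 + M by lra.
have M1' : 1 + M != 0 by rewrite gt_eqF.
have t0 : 0 <= ratr (trans W q a) :> R.
  by rewrite ratr_trans mean_ge0.
have := mean_killed a (fun x => Phi x + M) q; rewrite meanD mean_cst.
have [qB|qB] := boolP (q \in B).
  have Pq := MB _ qB; move=> e.
  apply: (@le_trans _ _ M).
    have := mulr_ge0 (le_trans ler01 (Phi1 a)) t0; lra.
  rewrite [leRHS]mulrAC ler_pdivlMr //; have := Phi1 q; nra.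
have Pq := lyapunov_mean qB; move=> e.
apply: (@le_trans _ _ (ratr gamma * Phi q + M : R)).
  have := mulr_ge0 (addr_ge0 (le_trans ler01 (Phi1 a)) M0) t0; lra.
rewrite [leRHS]mulrAC ler_pdivlMr //.
have P1 : 0 <= Phi q - 1 by rewrite subr_ge0.
have g1' : 0 <= 1 - ratr gamma :> R by rewrite subr_ge0 ltW.
have := mulr_ge0 M0 (mulr_ge0 P1 g1'); nra.
Qed.
End Lyapunov.

(** * Building blocks of the program *)

Definition vseq (s : seq value) : value := foldr VCons VNil s.

Definition vrats (I : Type) (f : I -> rat) (s : seq I) : value :=
  vseq [seq VRat (f i) | i <- s].

Definition p_hd e := ECase e ENil (EVar 0).
Definition p_tl e := ECase e ENil (EVar 1).
Definition p_nth n e := p_hd (iter n p_tl e).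

Definition app2 f x y := EApp (EApp f x) y.
Definition app3 f x y z := EApp (app2 f x y) z.

Lemma evalto_nth env e s n v :
  evalto env e (vseq s) -> onth s n = Some v -> evalto env (p_nth n e) v.
Proof.
rewrite /p_nth /p_hd => es sn.
have [h [t [st <-]]] : exists h t, evalto env (iter n p_tl e) (VCons h t) /\ h = v.
  elim: n s e es sn => [|n IH] [|x s] e es //=.
    by case=> <-; exists x, (vseq s).
  move=> sn; rewrite -iterS iterSr; apply: IH sn.
  exact: evalto_CaseCons es (evalto_Var _).
exact: evalto_CaseCons st (evalto_Var _).
Qed.

(** The three operations on vectors needed below are instances of one recursion
    on two lists of the same length.  In [p_step], the heads of the two lists are
    the variables 2 and 0, and [zip_rec] is the recursive call. *)
Section Zip.
Variables (p_nil p_step : expr).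

Definition p_zip :=
  EFun (EFun (ECase (EVar 2) p_nil (ECase (EVar 2) p_nil p_step))).

Definition zip_rec := app2 (EVar 7) (EVar 3) (EVar 1).

Lemma evalto_zip (I : Type) (f g : I -> rat) (res : seq I -> value) :
    (forall env, evalto env p_nil (res [::])) ->
    (forall env i s, evalto env zip_rec (res s) ->
       onth env 0 = Some (VRat (g i)) -> onth env 2 = Some (VRat (f i)) ->
       evalto env p_step (res (i :: s))) ->
  forall s env e1 e2, evalto env e1 (vrats f s) -> evalto env e2 (vrats g s) ->
  evalto env (app2 p_zip e1 e2) (res s).
Proof.
move=> nilP stepP s env e1 e2 ev1 ev2.
apply: evalto_App (evalto_App (evalto_Fun _ _) ev1 (evalto_Fun _ _)) ev2 _.
elim: s {ev1} => [|i s IH] /=.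
  by apply: evalto_CaseNil (evalto_Var _) (nilP _).
apply: evalto_CaseCons (evalto_Var _) _ => //=.
apply: evalto_CaseCons (evalto_Var _) _ => //=.
apply: stepP => //; apply: evalto_App IH; last exact: evalto_Var.
apply: evalto_App (evalto_Fun _ _); exact: evalto_Var.
Qed.
End Zip.

Definition p_add := p_zip ENil (ECons (EOp OAdd (EVar 2) (EVar 0)) zip_rec).

Definition p_eq := p_zip (ERat 1)
  (EIfLe (EVar 2) (EVar 0) (EIfLe (EVar 0) (EVar 2) zip_rec (ERat 0)) (ERat 0)).

Definition p_face := p_zip (ERat 1)
  (EIfLe (EVar 2) (ERat 0)
     (EIfLe (EVar 0) (ERat 0) zip_rec (ERat 0))
     (EIfLe (ERat 1) (EVar 0) zip_rec (ERat 0))).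

Lemma evalto_add (I : Type) (f g : I -> rat) s env e1 e2 :
  evalto env e1 (vrats f s) -> evalto env e2 (vrats g s) ->
  evalto env (app2 p_add e1 e2) (vrats (fun i => f i + g i) s).
Proof.
apply: evalto_zip => [*|env' i s' ev g0 f2]; first exact: evalto_Nil.
by apply: evalto_Cons ev; apply: (evalto_Op OAdd); apply: evalto_Var.
Qed.

Lemma evalto_eq (I : Type) (f g : I -> rat) s env e1 e2 :
  evalto env e1 (vrats f s) -> evalto env e2 (vrats g s) ->
  evalto env (app2 p_eq e1 e2) (VRat (all (fun i => f i == g i) s)%:R).
Proof.
apply: (@evalto_zip _ _ _ _ _ (fun s => VRat (all (fun i => f i == g i) s)%:R)).
  by move=> env'; exact: evalto_Rat.
move=> env' i s' ev g0 f2 /=.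
apply: evalto_IfLe (evalto_Var f2) (evalto_Var g0) _.
case: (ltgtP (f i) (g i)) => fg /=.
- apply: evalto_IfLe (evalto_Var g0) (evalto_Var f2) _.
  by rewrite leNgt fg; exact: evalto_Rat.
- exact: evalto_Rat.
apply: evalto_IfLe (evalto_Var g0) (evalto_Var f2) _.
by rewrite fg lexx.
Qed.

Lemma evalto_face (I : Type) (p : pred I) (f : I -> nat) s env e1 e2 :
  evalto env e1 (vrats (fun i => (p i)%:R) s) ->
  evalto env e2 (vrats (fun i => (f i)%:R) s) ->
  evalto env (app2 p_face e1 e2) (VRat (all (fun i => p i == (0 < f i)%N) s)%:R).
Proof.
apply: (@evalto_zip _ _ _ _ _
  (fun s => VRat (all (fun i => p i == (0 < f i)%N) s)%:R)).
  by move=> env'; exact: evalto_Rat.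
move=> env' i s' ev g0 f2 /=.
apply: evalto_IfLe (evalto_Var f2) (evalto_Rat _ _) _; rewrite lern0.
case: (p i) => /=.
  apply: evalto_IfLe (evalto_Rat _ _) (evalto_Var g0) _.
  by rewrite ler1n; case: (f i) => [|n] //=; exact: evalto_Rat.
apply: evalto_IfLe (evalto_Var g0) (evalto_Rat _ _) _; rewrite lern0.
by case: (f i) => [|n] //=; exact: evalto_Rat.
Qed.

Section Evals.
Variable R : realType.
Implicit Types (x y : R).

(** The programs work with rationals while the proof needs reals; this relation
    keeps the rational implicit. *)
Definition evals env e x := exists2 r, evalto env e (VRat r) & ratr r = x.

(** [c] is a closure; its body is run with the argument [v] as variable 0 and
    [c] itself as variable 1. *)
Definition returns (c v : value) x :=
  exists env b, c = VFun env b /\ evals (v :: c :: env) b x.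

Lemma evals_app env f a c v x :
  evalto env f c -> evalto env a v -> returns c v x -> evals env (EApp f a) x.
Proof.
move=> fc av [env' [b [e [r br <-]]]]; rewrite {}e in fc br.
by exists r => //; apply: evalto_App fc av br.
Qed.

Lemma evals0 env : evals env (ERat 0) 0.
Proof. by exists 0; rewrite ?rmorph0 //; exact: evalto_Rat. Qed.

Lemma evals1 env : evals env (ERat 1) 1.
Proof. by exists 1; rewrite ?rmorph1 //; exact: evalto_Rat. Qed.

Lemma evals_add env e1 e2 x y :
  evals env e1 x -> evals env e2 y -> evals env (EOp OAdd e1 e2) (x + y).
Proof.
move=> [r1 ev1 <-] [r2 ev2 <-]; exists (r1 + r2); last by rewrite rmorphD.
exact: (evalto_Op OAdd ev1 ev2).
Qed.

Lemma evals_sub env e1 e2 x y :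
  evals env e1 x -> evals env e2 y -> evals env (EOp OSub e1 e2) (x - y).
Proof.
move=> [r1 ev1 <-] [r2 ev2 <-]; exists (r1 - r2); last by rewrite rmorphB.
exact: (evalto_Op OSub ev1 ev2).
Qed.

Lemma evals_mul env e1 e2 x y :
  evals env e1 x -> evals env e2 y -> evals env (EOp OMul e1 e2) (x * y).
Proof.
move=> [r1 ev1 <-] [r2 ev2 <-]; exists (r1 * r2); last by rewrite rmorphM.
exact: (evalto_Op OMul ev1 ev2).
Qed.

Lemma evals_div env e1 e2 x y :
  evals env e1 x -> evals env e2 y -> evals env (EOp ODiv e1 e2) (x / y).
Proof.
move=> [r1 ev1 <-] [r2 ev2 <-]; exists (r1 / r2); last by rewrite fmorph_div.
exact: (evalto_Op ODiv ev1 ev2).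
Qed.

Lemma evals_ifle env e1 e2 e3 e4 (r1 r2 : rat) x :
  evalto env e1 (VRat r1) -> evalto env e2 (VRat r2) ->
  evals env (if r1 <= r2 then e3 else e4) x -> evals env (EIfLe e1 e2 e3 e4) x.
Proof.
by move=> ev1 ev2 [r ev <-]; exists r => //; apply: evalto_IfLe ev1 ev2 ev.
Qed.

Lemma evals_case_cons env e h t e1 e2 x :
  evalto env e (VCons h t) -> evals (h :: t :: env) e2 x ->
  evals env (ECase e e1 e2) x.
Proof.
by move=> ev [r ev2 <-]; exists r => //; apply: evalto_CaseCons ev ev2.
Qed.

Definition p_sum := EFun (EFun (ECase (EVar 0) (ERat 0)
  (EOp OAdd (EApp (EVar 4) (EVar 0)) (EApp (EVar 3) (EVar 1))))).

Lemma evals_sum (I : eqType) (enc : I -> value) (F : I -> R) (c : value)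
    (s : seq I) env e1 e2 :
    evalto env e1 c -> evalto env e2 (vseq (map enc s)) ->
    (forall i, i \in s -> returns c (enc i) (F i)) ->
  evals env (app2 p_sum e1 e2) (\sum_(i <- s) F i).
Proof.
move=> ev1 ev2 cF.
apply: evals_app (evalto_App (evalto_Fun _ _) ev1 (evalto_Fun _ _)) ev2 _.
elim: s cF => [|i s IH] cF.
  rewrite big_nil; do 2 eexists; split; first by [].
  exists 0; last by rewrite rmorph0.
  exact: evalto_CaseNil (evalto_Var _) (evalto_Rat _ _).
rewrite big_cons; do 2 eexists; split; first by [].
apply: evals_case_cons (evalto_Var _) _ => //; apply: evals_add.
  by apply: evals_app (cF i (mem_head _ _)); exact: evalto_Var.
apply: evals_app (IH _) => [| |j js]; try exact: evalto_Var.
by apply: cF; rewrite inE js orbT.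
Qed.

Definition vstate (d : nat) (q : state d) : value :=
  vrats (fun i => (q i)%:R) (enum 'I_d).

Definition vset (d : nat) (L : {set 'I_d}) : value :=
  vrats (fun i => (i \in L)%:R) (enum 'I_d).

Definition vincrement (d : nat) (D : increment d) : value :=
  vrats (fun i => (incr_val D i)%:~R) (enum 'I_d).

Definition vrule (d : nat) (W : walk d) (LD : {set 'I_d} * increment d) : value :=
  vseq [:: vset LD.1; vincrement LD.2; VRat (prob W LD.1 LD.2)].

Definition rules (d : nat) :=
  [seq (L, D) | L <- enum {set 'I_d}, D <- enum (increment d)].

Definition vwalk (d : nat) (W : walk d) : value :=
  vseq [seq vrule W LD | LD <- rules d].

Lemma all_enum_eq (I : finType) (T : eqType) (f g : I -> T) :
  all (fun i => f i == g i) (enum I) = [forall i, f i == g i].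
Proof.
by apply/allP/forallP => [fg i|fg i _]; [apply: fg; rewrite mem_enum | exact: fg].
Qed.

Lemma evalto_eq_state (d : nat) (q q' : state d) env e1 e2 :
  evalto env e1 (vstate q) -> evalto env e2 (vstate q') ->
  evalto env (app2 p_eq e1 e2) (VRat (q == q')%:R).
Proof.
move=> ev1 ev2; have := evalto_eq ev1 ev2; rewrite all_enum_eq.
have -> // : [forall i, (q i)%:R == (q' i)%:R :> rat] = (q == q').
apply/forallP/eqP => [qq|-> //]; apply/ffunP => i; apply/eqP.
by rewrite -(eqr_nat rat) qq.
Qed.

Lemma evalto_face_state (d : nat) (L : {set 'I_d}) (q : state d) env e1 e2 :
  evalto env e1 (vset L) -> evalto env e2 (vstate q) ->
  evalto env (app2 p_face e1 e2) (VRat (L == face q)%:R).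
Proof.
move=> ev1 ev2; have := evalto_face ev1 ev2; rewrite all_enum_eq.
have -> // : [forall i, (i \in L) == (0 < q i)%N] = (L == face q).
apply/forallP/eqP => [Lq|-> i]; last by rewrite inE.
by apply/setP => i; rewrite inE (eqP (Lq i)).
Qed.

Lemma evalto_add_state (d : nat) (W : walk d) q D env e1 e2 :
  prob W (face q) D != 0 ->
  evalto env e1 (vstate q) -> evalto env e2 (vincrement D) ->
  evalto env (app2 p_add e1 e2) (vstate (step q D)).
Proof.
move=> pD ev1 ev2; have := evalto_add ev1 ev2.
suff -> : vrats (fun i => (q i)%:R + (incr_val D i)%:~R) (enum 'I_d) =
  vstate (step q D) by [].
congr vseq; apply: eq_map => i; congr VRat.
have := step_eq (step q D) pD; rewrite eqxx => /forallP /(_ i) /eqP <-.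
by rewrite intrB !pmulrn addrC subrK.
Qed.

(** The contribution of the rule (L, D, p), which is variable 0, to the mean at q
    (variable 2) of the function computed by variable 4.  Rules with p = 0 must
    be skipped before they are applied, since they may lead out of the orthant,
    where that function need not terminate. *)
Definition p_rule := EIfLe (p_nth 2 (EVar 0)) (ERat 0) (ERat 0)
  (EIfLe (ERat 1) (app2 p_face (p_nth 0 (EVar 0)) (EVar 2))
     (EOp OMul (p_nth 2 (EVar 0))
        (EApp (EVar 4) (app2 p_add (EVar 2) (p_nth 1 (EVar 0)))))
     (ERat 0)).

Definition p_mean := EFun (EFun (EFun (app2 p_sum (EFun p_rule) (EVar 4)))).

Lemma evals_mean (d : nat) (W : walk d) (f : state d -> R) c q env e1 e2 e3 :
    evalto env e1 (vwalk W) -> evalto env e2 c -> evalto env e3 (vstate q) ->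
    (forall q', returns c (vstate q') (f q')) ->
  evals env (app3 p_mean e1 e2 e3) (mean W f q).
Proof.
move=> ev1 ev2 ev3 cf.
(* The program scans the rules of all faces, not only those of the face of q. *)
have -> : mean W f q = \sum_(LD <- rules d) (LD.1 == face q)%:R *
    (ratr (prob W LD.1 LD.2) * f (step q LD.2)).
  rewrite big_allpairs_dep /= big_enum /= (bigD1 (face q)) //= eqxx.
  rewrite [X in _ + X]big1 => [|L /negbTE Lq]; last first.
    by rewrite big1 // => D _; rewrite Lq mul0r.
  rewrite addr0 big_enum /=; apply: eq_bigr => D _; exact/esym/mul1r.
apply: evals_app (evalto_App (evalto_App (evalto_Fun _ _) ev1 (evalto_Fun _ _))
  ev2 (evalto_Fun _ _)) ev3 _.
do 2 eexists; split; first by [].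
apply: (@evals_sum _ (vrule W)) => [| |[L D] _]; first exact: evalto_Fun.
  exact: evalto_Var.
do 2 eexists; split; first by [].
rewrite /p_rule /=.
set env' := (vrule W (L, D) :: _).
have rule n v : onth [:: vset L; vincrement D; VRat (prob W L D)] n = Some v ->
    evalto env' (p_nth n (EVar 0)) v.
  by apply: evalto_nth; exact: evalto_Var.
apply: evals_ifle (rule 2 _ erefl) (evalto_Rat _ _) _.
case: (lerP (prob W L D) 0) => [p0|p0].
  rewrite (_ : prob W L D = 0); last by apply/eqP; rewrite eq_le p0 prob_ge0.
  rewrite rmorph0 mul0r mulr0; exact: evals0.
apply: evals_ifle (evalto_Rat _ _) (evalto_face_state (rule 0 _ erefl) _) _.
  exact: evalto_Var.
have [Lq|Lq] := eqVneq L (face q); last first.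
  rewrite /= mul0r; exact: evals0.
rewrite /= mul1r; apply: evals_mul.
  by exists (prob W L D) => //; exact: rule 2 _ erefl.
apply: evals_app (cf _); first exact: evalto_Var.
apply: (evalto_add_state (W := W) _ _ (rule 1 _ erefl)).
  by rewrite -Lq gt_eqF.
exact: evalto_Var.
Qed.

End Evals.

(** * The algorithm *)

(** Variables: 0 the new state, 4 the level w, 5 the closure that awaits a level
    and a state, 10 the factor rho, 12 the state a. *)
Definition p_killed_visits := EIfLe (ERat 1) (app2 p_eq (EVar 0) (EVar 12)) (ERat 0)
  (app2 (EVar 5) (EOp OMul (EVar 4) (EVar 10)) (EVar 0)).

(** Variables: 0 the state, 2 the level w, 4 the function f, 6 the threshold eps,
    12 the walk.  The number n of remaining steps is not represented: it is the
    first n with w rho^n <= eps. *)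
Definition p_occupation_body := EIfLe (EVar 2) (EVar 6) (ERat 0)
  (EOp OAdd (EApp (EVar 4) (EVar 0))
     (app3 p_mean (EVar 12) (EFun p_killed_visits) (EVar 0))).

Definition p_occupation :=
  EFun (EFun (EFun (EFun (EFun (EFun (EFun p_occupation_body)))))).

(** [env0] is the environment reached once the walk, a, rho, eps and f, in this
    order, have been passed to [p_occupation]; every second slot holds a
    closure. *)
Lemma evals_occupation_loop (R : realType) (d : nat) (W : walk d) (a : state d)
    (f : state d -> R) (rho eps : rat) c env0 :
    (forall q, returns c (vstate q) (f q)) ->
    onth env0 0 = Some c -> onth env0 2 = Some (VRat eps) ->
    onth env0 4 = Some (VRat rho) -> onth env0 6 = Some (vstate a) ->
    onth env0 8 = Some (vwalk W) ->
  forall n w q env e1 e2 e3,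
    (forall k, (w * rho ^+ k <= eps) = (n <= k)%N) ->
    evalto env e1 (VFun env0 (EFun p_occupation_body)) ->
    evalto env e2 (VRat w) -> evalto env e3 (vstate q) ->
  evals env (app2 e1 e2 e3) (occupation W a n f q).
Proof.
move=> cf env0c env0e env0r env0a env0w.
elim=> [|n IH] w q env e1 e2 e3 wn ev1 ev2 ev3;
  apply: evals_app (evalto_App ev1 ev2 (evalto_Fun _ _)) ev3 _;
  (do 2 eexists; split; first by []);
  (apply: evals_ifle; [exact: (@evalto_Var _ 2) | apply: evalto_Var; exact: env0e |]);
  have := wn 0; rewrite mulr1 => ->.
  exact: evals0.
apply: evals_add.
  by apply: evals_app (cf q); [apply: evalto_Var; exact: env0c | exact: evalto_Var].
apply: evals_mean; [apply: evalto_Var; exact: env0w | exact: evalto_Fun |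
  exact: (@evalto_Var _ 0) | move=> q'].
do 2 eexists; split; first by [].
apply: evals_ifle; [exact: evalto_Rat |
  by apply: evalto_eq_state;
    [exact: (@evalto_Var _ 0) | apply: evalto_Var; exact: env0a] |].
case: eqP => [_|_] /=.
  by rewrite mul0r; exact: evals0.
rewrite mul1r; apply: (IH (w * rho)) => [k| | |]; try exact: evalto_Var.
  by rewrite -mulrA -exprS wn ltnS.
by apply: (evalto_Op OMul);
  [exact: (@evalto_Var _ 4) | apply: evalto_Var; exact: env0r].
Qed.

Lemma evals_occupation (R : realType) (d : nat) (W : walk d) (a : state d)
    (f : state d -> R) (rho eps w : rat) n c q env e1 e2 e3 e4 e5 e6 e7 :
    evalto env e1 (vwalk W) -> evalto env e2 (vstate a) ->
    evalto env e3 (VRat rho) -> evalto env e4 (VRat eps) ->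
    evalto env e5 c -> evalto env e6 (VRat w) -> evalto env e7 (vstate q) ->
    (forall q', returns c (vstate q') (f q')) ->
    (forall k, (w * rho ^+ k <= eps) = (n <= k)%N) ->
  evals env (app2 (app2 (app3 p_occupation e1 e2 e3) e4 e5) e6 e7)
    (occupation W a n f q).
Proof.
move=> ev1 ev2 ev3 ev4 ev5 ev6 ev7 cf wn.
apply: (evals_occupation_loop (rho := rho) (eps := eps) cf _ _ _ _ _ wn _ ev6 ev7);
  last first.
  apply: evalto_App ev5 (evalto_Fun _ _); apply: evalto_App ev4 (evalto_Fun _ _).
  apply: evalto_App ev3 (evalto_Fun _ _); apply: evalto_App ev2 (evalto_Fun _ _).
  by apply: evalto_App ev1 (evalto_Fun _ _); exact: evalto_Fun.
all: by [].
Qed.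

Lemma evalto_enc_seq (I : Type) (enc : I -> expr) (v : I -> value) env s :
  (forall i, evalto env (enc i) (v i)) ->
  evalto env (enc_seq [seq enc i | i <- s]) (vseq [seq v i | i <- s]).
Proof.
by move=> ev; elim: s => [|i s IH]; [exact: evalto_Nil | exact: evalto_Cons].
Qed.

Lemma evalto_enc_state d (q : state d) env : evalto env (enc_state q) (vstate q).
Proof. by apply: evalto_enc_seq => i; exact: evalto_Rat. Qed.

Definition vinput d (W : walk d) gamma (B : seq (state d)) (x0 : state d) eps :=
  vseq [:: VRat d%:R; vwalk W; VRat gamma; vseq [seq vstate q | q <- B];
           vstate x0; VRat eps].

Lemma evalto_enc_walk d (W : walk d) env : evalto env (enc_walk W) (vwalk W).
Proof.
rewrite /enc_walk /vwalk /rules map_allpairs.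
have -> : [seq enc_seq [:: enc_set L; enc_increment D; ERat (prob W L D)]
   | L <- enum {set 'I_d}, D <- enum (increment d)] =
  [seq enc_seq [:: enc_set LD.1; enc_increment LD.2; ERat (prob W LD.1 LD.2)]
   | LD <- rules d] by rewrite map_allpairs.
rewrite -(map_allpairs (vrule W) pair); apply: evalto_enc_seq => -[L D].
do 3 (apply: evalto_Cons; first by do ?[apply: evalto_enc_seq => i]; exact: evalto_Rat).
exact: evalto_Nil.
Qed.

Lemma evalto_enc_input d (W : walk d) gamma B (x0 : state d) eps env :
  evalto env (enc_input W gamma B x0 eps) (vinput W gamma B x0 eps).
Proof.
apply: evalto_Cons (evalto_Rat _ _) _.
apply: evalto_Cons (evalto_enc_walk _ _) _.
apply: evalto_Cons (evalto_Rat _ _) _.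
apply: evalto_Cons _ _.
  by apply: evalto_enc_seq => q; exact: evalto_enc_state.
apply: evalto_Cons (evalto_enc_state _ _) _.
by apply: evalto_Cons (evalto_Rat _ _) (evalto_Nil _).
Qed.

(** The parts of [p_lyapunov_shift].  In [p_return_cost], variable 0 is a state x
    of B, 2 is the input and 4 is the program for Phi; under one more binder
    these become 2, 4 and 6. *)
Definition p_upper_bound := EOp OAdd (app2 (EVar 6) (EVar 0) (ERat 1)) (ERat 1).
Definition p_is_atom := app2 p_eq (EVar 0) (p_nth 0 (p_nth 3 (EVar 4))).
Definition p_return_cost := EOp ODiv
  (app3 p_mean (p_nth 1 (EVar 2)) (EFun p_upper_bound) (EVar 0))
  (app3 p_mean (p_nth 1 (EVar 2)) (EFun p_is_atom) (EVar 0)).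
Definition p_lyapunov_shift := app2 p_sum (EFun p_return_cost) (p_nth 3 (EVar 0)).

(** From here on variable 0 is M, 2 is the input and 4 is the program for Phi. *)
Definition p_one_plus_shift := EOp OAdd (ERat 1) (EVar 0).
Definition p_decay_rate :=
  EOp ODiv (EOp OAdd (p_nth 2 (EVar 2)) (EVar 0)) p_one_plus_shift.
Definition p_atom := p_nth 0 (p_nth 3 (EVar 2)).
Definition p_tail_scale := EOp ODiv
  (EOp OMul
     (EOp OAdd (EOp OAdd (app2 (EVar 4) p_atom (ERat 1)) (ERat 1)) (EVar 0))
     p_one_plus_shift)
  (EOp OSub (ERat 1) (p_nth 2 (EVar 2))).
Definition p_visits p_f :=
  app2 (app2 (app3 p_occupation (p_nth 1 (EVar 2)) p_atom p_decay_rate)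
          (p_nth 5 (EVar 2)) (EFun p_f))
    p_tail_scale p_atom.
Definition p_ratio_of_visits := EOp ODiv
  (p_visits (app2 p_eq (EVar 0) (p_nth 4 (EVar 4)))) (p_visits (ERat 1)).
Definition p_algorithm :=
  EFun (EFun (EApp (EFun p_ratio_of_visits) p_lyapunov_shift)).

(** The oracle for Phi is only known to work on literals in the empty
    environment.  Evaluation being deterministic, it behaves in the same way
    wherever its value and the value of its argument are available. *)
Lemma evalto_app2_transfer P vP e v x r env eP ex :
    evalto [::] P vP -> evalto [::] e v ->
    evalto [::] (app2 P e (ERat x)) (VRat r) ->
    evalto env eP vP -> evalto env ex v ->
  evalto env (app2 eP ex (ERat x)) (VRat r).
Proof.
move=> PvP ev evr evP evx.
inversion_clear evr as [| |? ? ? env1 b1 v1 ? ev1 evx1 evb1| | | | | | |].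
inversion_clear ev1 as [| |? ? ? env2 b2 v2 ? ev2 evx2 evb2| | | | | | |].
rewrite (evalto_det PvP ev2) in evP; rewrite (evalto_det ev evx2) in evx.
inversion evx1; subst.
exact: evalto_App (evalto_App evP evx evb2) (evalto_Rat _ _) evb1.
Qed.

Lemma bigmin_gt0 (I : eqType) (s : seq I) (F : I -> rat) i :
  0 < \big[Num.min/1]_(j <- s) F j -> i \in s -> 0 < F i.
Proof.
elim: s => [//|j s IH]; rewrite big_cons lt_min inE => /andP [Fj sF].
by case/orP => [/eqP ->|]; last exact: IH.
Qed.

Lemma pmin_gt0 d (W : walk d) B x y :
  0 < pmin W B -> x \in B -> y \in B -> 0 < trans W x y.
Proof. by move=> p0 xB yB; apply: bigmin_gt0 (bigmin_gt0 p0 xB) yB. Qed.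

(** [Phi'] stands for the upper bound of Phi obtained by adding 1 to its
    approximation within 1. *)
Section Algorithm.
Variables (R : realType) (d : nat) (W : walk d).
Variables (Phi' : state d -> R) (gamma : rat) (a : state d) (B : seq (state d)).
Variables (x0 : state d) (eps : rat) (vP : value).
Hypothesis PhiP : forall env eP ex q, evalto env eP vP ->
  evalto env ex (vstate q) ->
  evals env (EOp OAdd (app2 eP ex (ERat 1)) (ERat 1)) (Phi' q).

Let input := vinput W gamma (a :: B) x0 eps.

(** The least M with M p(x, a) >= E_x Phi'(Q(1)) would be a maximum over x in B; a
    sum is simpler to program. *)
Definition lyapunov_shift : R :=
  \sum_(x <- a :: B) mean W Phi' x / ratr (trans W x a).

Lemma evals_lyapunov_shift env : onth env 0 = Some input -> onth env 2 = Some vP ->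
  evals env p_lyapunov_shift lyapunov_shift.
Proof.
move=> env0 env2; apply: (@evals_sum _ _ (@vstate d)); first exact: evalto_Fun.
  by apply: evalto_nth; [apply: evalto_Var; exact: env0 | ].
move=> x _; do 2 eexists; split; first by []; rewrite ratr_trans.
apply: evals_div; apply: evals_mean.
- by apply: evalto_nth; [apply: evalto_Var; exact: env0 | ].
- exact: evalto_Fun.
- exact: evalto_Var.
- move=> q; do 2 eexists; split; first by [].
  by apply: PhiP; apply: evalto_Var => //; exact: env2.
- by apply: evalto_nth; [apply: evalto_Var; exact: env0 | ].
- exact: evalto_Fun.
- exact: evalto_Var.
move=> q; do 2 eexists; split; first by [].
exists (q == a)%:R; last by rewrite ratr_nat.
apply: evalto_eq_state; first exact: evalto_Var.
apply: (@evalto_nth _ _ (vstate a :: map (@vstate d) B)) => //.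
by apply: evalto_nth; [apply: evalto_Var; exact: env0 | ].
Qed.

Definition decay_rate : R := (ratr gamma + lyapunov_shift) / (1 + lyapunov_shift).

(** An upper bound of V(a) / (1 - rho) for V = Phi + M, since
    1 - rho = (1 - gamma) / (1 + M). *)
Definition tail_scale : R :=
  (Phi' a + lyapunov_shift) * (1 + lyapunov_shift) / (1 - ratr gamma).

Lemma evals_ratio_of_visits env n :
    onth env 0 = Some input -> onth env 2 = Some vP ->
    (forall k, (tail_scale * decay_rate ^+ k <= ratr eps) = (n <= k)%N) ->
  evals env (EApp (EFun p_ratio_of_visits) p_lyapunov_shift)
    (occupation W a n (fun q => (q == x0)%:R) a /
     occupation W a n (fun=> 1) a : R).
Proof.
move=> env0 env2 nP; have [m mP mM] := evals_lyapunov_shift env0 env2.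
apply: evals_app (evalto_Fun _ _) mP _; do 2 eexists; split; first by [].
set env' := VRat m :: _.
have ev_m : evals env' (EVar 0) lyapunov_shift by exists m => //; exact: evalto_Var.
have ev_field i v : onth [:: VRat d%:R; vwalk W; VRat gamma;
    vseq [seq vstate q | q <- a :: B]; vstate x0; VRat eps] i = Some v ->
    evalto env' (p_nth i (EVar 2)) v.
  by apply: evalto_nth; apply: evalto_Var; exact: env0.
have ev_gamma : evals env' (p_nth 2 (EVar 2)) (ratr gamma : R).
  by exists gamma => //; exact: ev_field.
have ev_a : evalto env' p_atom (vstate a).
  apply: (@evalto_nth _ _ (vstate a :: map (@vstate d) B)) => //.
  exact: ev_field.
have [rho rhoP rhoE] : evals env' p_decay_rate decay_rate.
  apply: evals_div; first exact: evals_add.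
  by apply: evals_add => //; exact: evals1.
have [w wP wE] : evals env' p_tail_scale tail_scale.
  apply: evals_div; last by apply: evals_sub => //; exact: evals1.
  apply: evals_mul; last by apply: evals_add => //; exact: evals1.
  apply: evals_add => //; apply: PhiP => //.
  by apply: evalto_Var; exact: env2.
have threshold k : (w * rho ^+ k <= eps) = (n <= k)%N.
  by rewrite -nP -wE -rhoE -rmorphXn -rmorphM ler_rat.
apply: evals_div;
  (apply: (evals_occupation _ ev_a rhoP _ _ wP ev_a _ threshold);
    [exact: ev_field | exact: ev_field | exact: evalto_Fun | move=> q]);
  (do 2 eexists; split; first by []).
  exists (q == x0)%:R; last by rewrite ratr_nat.
  apply: evalto_eq_state; first exact: evalto_Var.
  apply: (@evalto_nth _ _ [:: VRat d%:R; vwalk W; VRat gamma;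
    vseq [seq vstate q | q <- a :: B]; vstate x0; VRat eps]) => //.
  by apply: evalto_Var; exact: env0.
exact: evals1.
Qed.

End Algorithm.

Theorem theorem6 (R : realType) :
  exists A : expr,
  forall (d : nat) (W : walk d) (pi : state d -> R)
    (Phi : state d -> R) (P : expr) (gamma : rat) (B : seq (state d))
    (x0 : state d) (eps : rat),
  irreducible R W ->
  unique_stationary W pi ->
  geometric_lyapunov W Phi gamma B ->
  computes P Phi ->
  (nu W Phi < +oo)%E ->
  0 < pmin W B ->
  0 < eps ->
  exists xhat : rat,
    evalto [::] (EApp (EApp A P) (enc_input W gamma B x0 eps)) (VRat xhat) /\
    ratr xhat - ratr eps <= pi x0 <= ratr xhat + ratr eps.
Proof.
exists p_algorithm => d W pi Phi P gamma B x0 eps _ [piP _] lyap PhiC _ pB eps0.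
have := lyapunov_exception_nonempty lyap.
case: B lyap pB => [//|a B] lyap pB _.
have [approx approxP] := choice (fun q => PhiC q 1 ltr01).
have [vP PvP] : exists vP, evalto [::] P vP.
  have [+ _] := approxP a => evr.
  inversion_clear evr as [| |? ? ? env1 b1 v1 ? ev1 evx1 evb1| | | | | | |].
  by inversion_clear ev1 as [| |? ? ? env2 b2 v2 ? ev2 evx2 evb2| | | | | | |];
    exists (VFun env2 b2).
pose Phi' q : R := ratr (approx q) + 1.
have PhiP env eP ex q : evalto env eP vP -> evalto env ex (vstate q) ->
    evals env (EOp OAdd (app2 eP ex (ERat 1)) (ERat 1)) (Phi' q).
  move=> evP evx; apply: evals_add; last exact: evals1.
  exists (approx q) => //.
  exact: evalto_app2_transfer PvP (evalto_enc_state _ _) (approxP q).1 evP evx.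
have Phi_le q : Phi q <= Phi' q.
  by have [_] := approxP q; rewrite rmorph1 ler_norml => /andP []; rewrite /Phi'; lra.
have [Phi1 g01 _] := lyap.
have /andP [g0 g1] := ratr_lt01 R g01.
pose M := lyapunov_shift W Phi' a B.
have t0 x : x \in a :: B -> 0 < ratr (trans W x a) :> R.
  by move=> xB; rewrite ltr0q; apply: pmin_gt0 pB xB (mem_head _ _).
have K0 x : 0 <= mean W Phi' x.
  by apply: mean_ge0 => q; apply: le_trans (Phi_le q); apply: le_trans (Phi1 q).
have M0 : 0 <= M.
  rewrite /M /lyapunov_shift big_seq; apply: sumr_ge0 => x xB.
  by rewrite divr_ge0 // ltW // t0.
have MB x : x \in a :: B -> mean W Phi x <= M * ratr (trans W x a).
  move=> xB; apply: le_trans (le_mean W x Phi_le) _.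
  rewrite -ler_pdivrMr ?t0 // /M /lyapunov_shift (big_rem x xB) lerDl big_seq.
  by apply: sumr_ge0 => y /mem_rem yB; rewrite divr_ge0 // ltW // t0.
have drift := killed_drift lyap M0 MB.
have M1 : 0 < 1 + M by lra.
have g1' : 0 < 1 - ratr gamma :> R by rewrite subr_gt0.
have Phia : Phi a + M <= Phi' a + M by rewrite lerD2r.
have Va1 q : 1 <= Phi q + M by have := Phi1 q; lra.
pose rho := decay_rate W Phi' gamma a B.
pose w := tail_scale W Phi' gamma a B.
have rho01 : 0 < rho < 1.
  rewrite divr_gt0 ?ltr_pdivrMr //=; last by rewrite ltr_wpDr.
  by rewrite mul1r ltrD2r.
have w0 : 0 <= w.
  rewrite divr_ge0 ?mulr_ge0 ?(ltW M1) ?(ltW g1') //.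
  by rewrite (le_trans _ Phia) // (le_trans _ (Va1 a)).
have [n nP] := expr_mul_threshold rho01 w0 (etrans (ltr0q R eps) eps0).
have [xhat xhatP xhatE] : evals [::]
    (EApp (EApp p_algorithm P) (enc_input W gamma (a :: B) x0 eps))
    (occupation W a n (fun q => (q == x0)%:R) a /
     occupation W a n (fun=> 1) a : R).
  apply: evals_app (evalto_App (evalto_Fun _ _) PvP (evalto_Fun _ _))
    (evalto_enc_input _ _ _ _ _ _) _.
  do 2 eexists; split; first by [].
  by apply: (evals_ratio_of_visits PhiP _ _ nP).
exists xhat; split=> //.
rewrite -ler_distlC xhatE distrC.
apply: le_trans (ratio_estimate piP Va1 rho01 drift n x0) _.
apply: (@le_trans _ _ (w * rho ^+ n)); last by rewrite nP.
rewrite -mulrA [leRHS]mulrC ler_wpM2l ?exprn_ge0 ?(ltW (proj1 (andP rho01))) //.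
have -> : (1 - rho)^-1 = (1 + M) / (1 - ratr gamma).
  rewrite /rho /decay_rate -/M; field.
  by rewrite !gt_eqF //; lra.
by rewrite mulrA ler_wpM2r ?invr_ge0 ?(ltW g1') // ler_wpM2r // ltW.
Qed.
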